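(* Let $\beta$ satisfy $\beta/\beta_c>1$ and let $(k_N)$ be a sequence of positive integers such that, as $N\to\infty$, $$k_N\uparrow\infty,\qquad \frac{k_N}{N}\uparrow\infty,\qquad \frac{\log k_N}{N}\downarrow 0 .$$ Then with probability $1$, for all but a finite number of indices $N$, $$d_{\mathrm{TV}}\big(\mu_{N,\beta},\mu^{(1)}_{k_N,\beta}\big)\ \le\ \frac{4}{\beta/\beta_c-1}\;\frac{1}{(k_N-1)^{(\beta/\beta_c-1)/2}}.$$
   Context: $\beta_c:=\sqrt{2\log 2}$. For each $N$, let $\{(\sigma)_i:1\le i\le 2^N\}$ be an enumeration of $\{-1,+1\}^N$ and let $(X_i)_{1\le i\le 2^N}$ (depending on $N$) be i.i.d. standard Gaussian random variables, $X_i$ attached to $(\sigma)_i$, all families being defined on one common probability space $(\Omega,\Sigma,\mathbb P)$. The Gibbs measure of the random energy model is the random probability measure on $\{-1,+1\}^N$ $$\mu_{N,\beta}(\Psi)=\frac{\sum_{i=1}^{2^N}\Psi((\sigma)_i)e^{-\beta\sqrt N X_i}}{\sum_{i=1}^{2^N}e^{-\beta\sqrt N X_i}},\qquad \Psi:\{-1,+1\}^N\to\mathbb R .$$ $X_{1,2^N}\le\cdots\le X_{2^N,2^N}$ are the order statistics of $(X_i)$, and $(\tilde\sigma)_j$ is the (a.s. unique) configuration $(\sigma)_i$ with $X_i=X_{j,2^N}$. The approximating random probability measure on $\{-1,+1\}^N$ is $$\mu^{(1)}_{k_N,\beta}(\Psi):=\frac{\sum_{k=1}^{k_N}\Psi((\tilde\sigma)_k)\exp\left(-\frac{\beta}{\beta_c}\sqrt{2\log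 2^N}(X_{k,2^N}-X_{1,2^N})\right)}{\sum_{k=1}^{k_N}\exp\left(-\frac{\beta}{\beta_c}\sqrt{2\log 2^N}(X_{k,2^N}-X_{1,2^N})\right)}.$$ The total variation distance is $d_{\mathrm{TV}}(\mu,\nu)=\sup_{\Psi:\|\Psi\|_\infty=1}|\mu(\Psi)-\nu(\Psi)|$, with $\|\Psi\|_\infty=\sup_\sigma|\Psi(\sigma)|$. *)

(* Defs.v *)
From mathcomp Require Export all_boot all_order all_algebra.
From mathcomp Require Export all_classical all_reals all_analysis.

Set Implicit Arguments.
Unset Strict Implicit.
Unset Printing Implicit Defensive.
Import Order.TTheory GRing.Theory Num.Theory.
Import numFieldNormedType.Exports.

Local Open Scope classical_set_scope.
Local Open Scope ring_scope.

(* The set {-1, +1} as a finite type. *)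
Definition spin := seq_sub [:: -1; 1 : int].

Definition config (N : nat) := {ffun 'I_N -> spin}.

(* The equality with [normal_prob 0 1] (mean 0, standard deviation 1) is only
   required on measurable sets, because both sides are total functions with
   arbitrary values on the other sets. *)
Definition standard_gaussian (R : realType) (d : measure_display)
    (T : measurableType d) (P : probability T R) (X : {RV P >-> R}) : Prop :=
  forall A : set R, measurable A -> distribution P X A = normal_prob 0 1 A.

Definition mutually_independent (R : realType) (d : measure_display)
    (T : measurableType d) (P : probability T R) (I : finType)
    (X : I -> {RV P >-> R}) : Prop :=
  forall (J : {set I}) (B : I -> set R), (forall i, measurable (B i)) ->
    P (\bigcap_(i in [set` J]) (X i @^-1` B i)) =
      (\prod_(i in J) P (X i @^-1` B i))%E.

Definition iid_standard_gaussian (R : realType) (d : measure_display)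
    (T : measurableType d) (P : probability T R) (I : finType)
    (X : I -> {RV P >-> R}) : Prop :=
  mutually_independent X /\ forall i, standard_gaussian (X i).

Section REM.
Variable R : realType.

Definition beta_c : R := Num.sqrt (2 * ln 2).

(* Measures on the finite set [config N] are given by their action on
   functions [Psi : config N -> R]. *)
Definition gibbs (N : nat) (beta : R) (sigma : 'I_(2 ^ N)%N -> config N)
    (x : 'I_(2 ^ N)%N -> R) (Psi : config N -> R) : R :=
  (\sum_i Psi (sigma i) * expR (- (beta * Num.sqrt N%:R * x i))) /
  (\sum_i expR (- (beta * Num.sqrt N%:R * x i))).

(* [order_stat x k], for [k < n], is the (k+1)-st smallest of the n values of
   [x], counted with multiplicity: X_{k+1,n} in the one-based numbering. *)
Definition order_stat (n : nat) (x : 'I_n -> R) (k : nat) : R :=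
  nth 0 (sort <=%R [seq x i | i <- enum 'I_n]) k.

(* An index i with x_i = X_{k+1,n}. One always exists, so the default [k] of
   [odflt] is never used; it is unique when the x_i are pairwise distinct. *)
Definition order_index (n : nat) (x : 'I_n -> R) (k : 'I_n) : 'I_n :=
  odflt k [pick i | x i == order_stat x k].

Definition order_config (N : nat) (sigma : 'I_(2 ^ N)%N -> config N)
    (x : 'I_(2 ^ N)%N -> R) (k : 'I_(2 ^ N)%N) : config N :=
  sigma (order_index x k).

Definition order_weight (N : nat) (beta : R) (x : 'I_(2 ^ N)%N -> R)
    (k : nat) : R :=
  expR (- (beta / beta_c * Num.sqrt (2 * ln (2 ^+ N)) *
           (order_stat x k - order_stat x 0))).

(* The one-based range 1 <= k <= K becomes 0 <= k < K. There are only 2^N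
   order statistics, so the sums stop at 2^N when K > 2^N. *)
Definition gibbs_approx (N K : nat) (beta : R)
    (sigma : 'I_(2 ^ N)%N -> config N) (x : 'I_(2 ^ N)%N -> R)
    (Psi : config N -> R) : R :=
  (\sum_(k < (2 ^ N)%N | (k < K)%N)
      Psi (order_config sigma x k) * order_weight beta x k) /
  (\sum_(k < (2 ^ N)%N | (k < K)%N) order_weight beta x k).

Definition supnorm (N : nat) (Psi : config N -> R) : R :=
  \big[Num.max/0]_(s : config N) `|Psi s|.

Definition dTV (N : nat) (mu nu : (config N -> R) -> R) : \bar R :=
  ereal_sup [set (`|mu Psi - nu Psi|)%:E |
              Psi in [set Psi : config N -> R | supnorm Psi = 1]].

(* Monotonicity is required from some index on, as part of the behaviour
   "as N -> oo". *)
Definition increases_to_infinity (u : nat -> R) : Prop :=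
  (\forall N \near \oo, u N <= u N.+1) /\ u N @[N --> \oo] --> +oo.

Definition decreases_to_zero (u : nat -> R) : Prop :=
  (\forall N \near \oo, u N.+1 <= u N) /\ u N @[N --> \oo] --> (0 : R).

End REM.

Arguments beta_c {R}.

(* Main.v *)
Require Import Defs.
From HB Require Import structures.
From mathcomp Require Import all_boot all_order all_algebra.
From mathcomp Require Import all_classical all_reals all_analysis.
From mathcomp Require Import measurable_realfun.
From mathcomp Require Import ring lra.
Set Implicit Arguments.
Unset Strict Implicit.
Unset Printing Implicit Defensive.
Import Order.TTheory GRing.Theory Num.Theory.
Import numFieldNormedType.Exports.
Local Open Scope classical_set_scope.
Local Open Scope ring_scope.

(** Write [b = beta / beta_c], [n = 2 ^ N], [a = sqrt (2 * ln n)] and let [Phi],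
    [phi] be the distribution function and density of the standard Gaussian
    law.  Because [beta * sqrt N = b * a], the approximating measure is the
    Gibbs measure conditioned on the [K = k N] smallest energies, provided
    these are pairwise distinct.  Hence the total variation distance is at most
    twice the sum of the relative weights [exp (- b * a * (X_j - X_1))] over
    [j > K] ([dTV_gibbs_le]).

    The variables [Phi (X_i)] are independent and uniform on [[0, 1]].  By
    union bounds and the Borel-Cantelli lemma, almost surely for all large [N]:
    there are no ties; no [X_i] is below [- t * a], where [t > 1] is a fixed
    constant; the smallest of the [Phi (X_i)] is at most [2 * ln N / n]; and
    the [j]-th smallest one is at least [j / (2 * e * n)] for all [j > K]
    ([prob_le_not_spread]).  The last point uses [K >= N], which makes
    [2 ^ - K] summable.

    To pass from ratios of [Phi] to differences of the [X_j] one uses that the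
    hazard rate [phi / Phi] is at most [t ^ 3 * a] on the right of [- t * a]
    when [a] is large: [Phi] grows at most at this exponential rate
    ([gauss_cdf_growth]).  A ratio [Phi (X_j) / Phi (X_1)] of at least
    [C * j / ln N] thus gives [X_j] a weight of at most
    [(ln N / (C * j)) ^ p] with [p = b / t ^ 3] ([order_weight_le]).  Using the
    ratio, rather than separate asymptotics for [X_j] and [X_1], matters: the
    factors [1 / a] in the Gaussian tails cancel, whereas a spurious power of
    [N] could not be absorbed.

    Summing over [j > K] gives [(ln N / C) ^ p * K ^ - (p - 1) / (p - 1)].  As
    [t] can be taken so close to 1 that [p - 1 > (b - 1) / 2], the power of
    [K >= N] that remains beats the power of [ln N], which is the claim
    ([dTV_le_of_spread]). *)

(** * Order statistics *)

Section order_statistics.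
Context {R : realType} {n : nat}.
Implicit Types x : 'I_n -> R.

Let svals x := sort <=%R [seq x i | i <- enum 'I_n].

Let size_svals x : size (svals x) = n.
Proof. by rewrite size_sort size_map size_enum_ord. Qed.

Lemma order_indexE x (k : 'I_n) : x (order_index x k) = order_stat x k.
Proof.
rewrite /order_index; case: pickP => [i /eqP //|/= no].
have /mapP[i _ ei] : order_stat x k \in [seq x i | i <- enum 'I_n].
  by rewrite -(mem_sort <=%R) mem_nth// size_svals.
by have := no i; rewrite -ei eqxx.
Qed.

Lemma order_stat_homo x (i j : nat) : (i <= j < n)%N ->
  order_stat x i <= order_stat x j.
Proof.
move=> /andP[ij jn]; apply: (sorted_leq_nth le_trans lexx 0) => //.
- exact: sort_le_sorted.
- by rewrite inE size_svals (leq_ltn_trans ij).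
- by rewrite inE size_svals.
Qed.

Lemma order_stat0_le x i : order_stat x 0 <= x i.
Proof.
have /(nthP 0)[j] : x i \in svals x by rewrite mem_sort map_f ?mem_enum.
by rewrite size_svals => jn <-; exact: order_stat_homo.
Qed.

Lemma order_index_inj x : injective x -> injective (order_index x).
Proof.
move=> xinj i j /(congr1 x); rewrite !order_indexE => /eqP.
rewrite nth_uniq ?size_svals ?ltn_ord// => [/eqP/val_inj //|].
by rewrite sort_uniq map_inj_uniq// enum_uniq.
Qed.

(** The property [Q] of values below a threshold holds for the first [j + 1]
    order statistics as soon as it holds for the last of them.  This turns a
    lower bound on an order statistic into a count of small values, which a
    union bound over index sets can control. *)
Lemma order_stat_lt_card x (Q : pred R) (j : nat) :
  (forall y z, y <= z -> Q z -> Q y) -> (j < n)%N -> Q (order_stat x j) ->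
  (j < #|[pred i | Q (x i)]|)%N.
Proof.
move=> Qle jn Qj.
have -> : #|[pred i | Q (x i)]| = count Q (svals x).
  rewrite (permP (permEl (perm_sort _ _))) count_map cardE.
  rewrite [in RHS]enumT /enum_mem size_filter; exact: eq_count.
rewrite -(cat_take_drop j.+1 (svals x)) count_cat ltn_addr//.
suff: all Q (take j.+1 (svals x)).
  by rewrite all_count => /eqP ->; rewrite size_takel// size_svals.
apply/(all_nthP 0) => i; rewrite size_takel ?size_svals// => ij.
rewrite nth_take//; apply: Qle Qj; apply: order_stat_homo.
by rewrite -ltnS ij jn.
Qed.

End order_statistics.

(** * Total variation distance to a truncated Gibbs measure *)

Section total_variation.
Context {R : realType}.

Lemma supnorm_ge N (Psi : config N -> R) s : `|Psi s| <= supnorm Psi.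
Proof. exact: (le_bigmax_cond _ (fun s => `|Psi s|)). Qed.

Lemma sqrt_2ln2N N : Num.sqrt (2 * ln (2 ^+ N)) = beta_c * Num.sqrt N%:R :> R.
Proof.
rewrite /beta_c -sqrtrM; last by rewrite mulr_ge0 ?ln_ge0 ?ler1n.
by rewrite lnXn// -[_ *+ N]mulr_natr mulrA.
Qed.

Lemma beta_c_gt0 : 0 < beta_c :> R.
Proof. by rewrite sqrtr_gt0 mulr_gt0// ln_gt0// ltr1n. Qed.

Lemma order_weight_gt0 N beta (x : 'I_(2 ^ N)%N -> R) k :
  0 < order_weight beta x k.
Proof. exact: expR_gt0. Qed.

(** Sorting reindexes the Gibbs sums bijectively because the values are
    pairwise distinct; since [beta_c * sqrt N = sqrt (2 * ln (2 ^ N))], the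
    Boltzmann factors and the order weights differ only by the common factor
    attached to the minimum, which cancels in the quotient. *)
Lemma gibbs_orderE N beta (sigma : 'I_(2 ^ N)%N -> config N)
    (x : 'I_(2 ^ N)%N -> R) Psi : injective x ->
  gibbs beta sigma x Psi =
  (\sum_k Psi (order_config sigma x k) * order_weight beta x k) /
  (\sum_(k < (2 ^ N)%N) order_weight beta x k).
Proof.
move=> xinj; pose c := expR (- (beta * Num.sqrt N%:R * order_stat x 0)).
have wE k : expR (- (beta * Num.sqrt N%:R * x (order_index x k))) =
    c * order_weight beta x k.
  rewrite order_indexE /c /order_weight -expRD sqrt_2ln2N; congr expR.
  by field; rewrite gt_eqF ?beta_c_gt0.
have bij := order_index_inj xinj.
rewrite /gibbs (reindex_inj bij) [in X in _ / X](reindex_inj bij)/=.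
under eq_bigr do rewrite wE mulrCA.
under [in X in _ / X]eq_bigr do rewrite wE.
rewrite -!big_distrr/= -mulf_div divff ?mul1r//.
by rewrite gt_eqF ?expR_gt0.
Qed.

(** With [A], [a] the restricted sums and [B], [r] the remainders, the
    difference is [(a * B - r * A) / (a * (a + r))], whose numerator is at
    most [2 * a * r] in absolute value. *)
Lemma normalized_restriction_le (I : finType) (Q : pred I) (w p : I -> R) :
  (forall i, 0 < w i) -> (forall i, `|p i| <= 1) -> 1 <= \sum_(i | Q i) w i ->
  `|(\sum_i p i * w i) / (\sum_i w i) -
    (\sum_(i | Q i) p i * w i) / (\sum_(i | Q i) w i)|
  <= 2 * \sum_(i | ~~ Q i) w i.
Proof.
move=> w0 p1.
have split (F : I -> R) :
    \sum_i F i = \sum_(i | Q i) F i + \sum_(i | ~~ Q i) F i.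
  by rewrite (bigID Q).
rewrite 2!split.
have sum_le (S : pred I) : `|\sum_(i | S i) p i * w i| <= \sum_(i | S i) w i.
  rewrite (le_trans (ler_norm_sum _ _ _))// ler_sum// => i _.
  by rewrite normrM (gtr0_norm (w0 i)) ler_piMl ?(ltW (w0 i)).
move: (sum_le Q) (sum_le (fun i => ~~ Q i)).
have : 0 <= \sum_(i | ~~ Q i) w i by rewrite sumr_ge0// => i _; exact/ltW.
move: (\sum_(i | Q i) p i * w i) (\sum_(i | ~~ Q i) p i * w i)
  (\sum_(i | ~~ Q i) w i) (\sum_(i | Q i) w i) => A B r a r0 Aa Br a1.
have a0 : 0 < a by exact: lt_le_trans ltr01 a1.
have ar0 : 0 < a + r by rewrite ltr_wpDr.
have -> : (A + B) / (a + r) - A / a = (a * B - r * A) / (a * (a + r)).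
  by field; rewrite !gt_eqF.
rewrite normrM normfV (gtr0_norm (mulr_gt0 a0 ar0)) ler_pdivrMr ?mulr_gt0//.
rewrite (le_trans (ler_normB _ _))// !normrM (gtr0_norm a0) (ger0_norm r0).
have h1 : a * `|B| <= a * r by rewrite ler_pM2l.
have h2 : r * `|A| <= r * a by rewrite ler_wpM2l.
have h3 : r * a * 1 <= r * a * (a + r).
  by rewrite ler_wpM2l ?mulr_ge0 ?(ltW a0)//; lra.
lra.
Qed.

(** The smallest value has weight 1, so the normalisation of the
    approximating measure is at least 1 and the distance is controlled by the
    weights that the truncation discards. *)
Lemma dTV_gibbs_le N K beta (sigma : 'I_(2 ^ N)%N -> config N)
    (x : 'I_(2 ^ N)%N -> R) : injective x -> (0 < K)%N ->
  (dTV (gibbs beta sigma x) (gibbs_approx K beta sigma x) <=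
   (2 * \sum_(k < (2 ^ N)%N | (K <= k)%N) order_weight beta x k)%:E)%E.
Proof.
move=> xinj K0; apply: ge_ereal_sup => _ [Psi /= Psi1 <-].
rewrite lee_fin gibbs_orderE//.
under [in leRHS]eq_bigl do rewrite leqNgt.
apply: normalized_restriction_le.
- by move=> k; exact: order_weight_gt0.
- by move=> k; rewrite -Psi1 supnorm_ge.
have n0 : (0 < 2 ^ N)%N by rewrite expn_gt0.
rewrite (bigD1 (Ordinal n0))//= {1}/order_weight subrr mulr0 oppr0 expR0.
by rewrite lerDl sumr_ge0// => k _; rewrite ltW ?order_weight_gt0.
Qed.

End total_variation.

(** * The Gaussian distribution function *)

Section gaussian.
Context {R : realType}.
Implicit Types s t x y : R.

Lemma le_of_derive_ge0 (f df : R -> R) (a b : R) : a <= b ->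
  (forall x, is_derive x 1 f (df x)) ->
  (forall x, a < x < b -> 0 <= df x) -> f a <= f b.
Proof.
rewrite le_eqVlt => /predU1P[-> //|ab] fdf df0.
have [|c cab] := @MVT _ f df a b ab (fun x _ => fdf x).
  apply: continuous_subspaceT => x.
  by apply: differentiable_continuous; apply/derivable1_diffP; case: (fdf x).
move=> /eqP; rewrite subr_eq => /eqP ->.
by rewrite lerDr mulr_ge0 ?subr_ge0 ?(ltW ab)// df0.
Qed.

Local Notation P := (@normal_prob R 0 1).

Definition gauss_density x : R := normal_peak 1 * expR (- (x ^+ 2 / 2)).

Local Notation phi := gauss_density.

Lemma normal_pdf01 : @normal_pdf R 0 1 = phi.
Proof.
apply/funext => x; rewrite normal_pdfE ?oner_eq0//.
by rewrite /normal_fun subr0 expr1n mulNr.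
Qed.

Lemma gauss_density_gt0 x : 0 < phi x.
Proof. by rewrite mulr_gt0 ?expR_gt0 ?normal_peak_gt0 ?oner_eq0. Qed.

Definition gauss_cdf x : R := fine (P `]-oo, x]).

Local Notation Phi := gauss_cdf.

Lemma gauss_cdfE x : P `]-oo, x] = (Phi x)%:E.
Proof. by rewrite fineK// fin_num_measure. Qed.

Lemma is_derive_gauss_cdf x : is_derive x 1 Phi (phi x).
Proof.
have [||||d1 d2] := @continuous_FTC1 R (normal_pdf 0 1) -oo%O x (x + 1) _ _ _.
- by rewrite ltrDl.
- exact/(integrableS _ _ (subsetT _))/integrable_normal_pdf.
- by rewrite /= ltNyr.
- by apply: continuous_normal_pdf; rewrite oner_eq0.
move: d1 d2; rewrite normal_pdf01 => d1 d2.
have -> : Phi = (fun x => (\int[lebesgue_measure]_(t in `]-oo, x]) phi t)%R).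
  by apply/funext => y; rewrite /Phi /normal_prob /Rintegral normal_pdf01.
by rewrite -d2 derive1E; exact/derivableP.
Qed.

Lemma continuous_gauss_cdf : continuous Phi.
Proof.
move=> x; apply: differentiable_continuous.
by apply/derivable1_diffP; case: (is_derive_gauss_cdf x).
Qed.

Lemma gauss_cdf_homo x y : x <= y -> Phi x <= Phi y.
Proof.
move=> xy; apply: (@le_of_derive_ge0 Phi phi x y xy is_derive_gauss_cdf) => z _.
exact/ltW/gauss_density_gt0.
Qed.

Lemma gauss_cdf_ge0 x : 0 <= Phi x.
Proof. by rewrite fine_ge0. Qed.

Lemma gauss_cdf_le1 x : Phi x <= 1.
Proof. by rewrite -lee_fin -gauss_cdfE probability_le1. Qed.

Let id_rv : measurableTypeR R -> R := idfun.

#[local] HB.instance Definition _ :=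
  @isMeasurableFun.Build _ _ _ _ id_rv (@measurable_id _ _ setT).

Lemma cvg_gauss_cdfNy0 : Phi x @[x --> -oo] --> (0 : R).
Proof.
have := @cvg_cdfNy0 _ _ _ P (id_rv : {RV P >-> R}).
by move/fine_cvg => /=; apply: cvg_trans; apply: near_eq_cvg; near=> x.
Unshelve. all: by end_near. Qed.

Lemma cvg_gauss_cdfy1 : Phi x @[x --> +oo] --> (1 : R).
Proof.
have := @cvg_cdfy1 _ _ _ P (id_rv : {RV P >-> R}).
by move/fine_cvg => /=; apply: cvg_trans; apply: near_eq_cvg; near=> x.
Unshelve. all: by end_near. Qed.

Lemma gauss_quantile u : 0 < u < 1 -> exists t, Phi t = u.
Proof.
move=> /andP[u0 u1].
have [a ua] : exists a, Phi a < u.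
  have /cvgr_lt/(_ _ u0) := cvg_gauss_cdfNy0.
  by move=> /filter_ex[a ?]; exists a.
have [b ub] : exists b, u < Phi b.
  have /cvgr_gt/(_ _ u1) := cvg_gauss_cdfy1.
  by move=> /filter_ex[b ?]; exists b.
have ab : a <= b.
  rewrite leNgt; apply/negP => /ltW/gauss_cdf_homo.
  by rewrite leNgt (lt_trans ua ub).
have [||c _ <-] := @IVT R Phi a b u ab; last by exists c.
  exact/continuous_subspaceT/continuous_gauss_cdf.
by rewrite ge_min le_max (ltW ua) (ltW ub) orbT.
Qed.

Lemma gauss_cdf_mono : {mono Phi : x y / x <= y}.
Proof.
apply: le_mono => x y xy; rewrite lt_neqAle gauss_cdf_homo ?ltW// andbT.
apply/eqP => Pxy.
have [|c _] := @MVT R Phi phi x y xy (fun z _ => is_derive_gauss_cdf z).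
  exact/continuous_subspaceT/continuous_gauss_cdf.
rewrite Pxy subrr => /esym/eqP.
by rewrite mulf_eq0 subr_eq0 !gt_eqF// gauss_density_gt0.
Qed.

Lemma gauss_cdf_gt0 x : 0 < Phi x.
Proof.
rewrite (le_lt_trans (gauss_cdf_ge0 (x - 1)))//.
by rewrite (leW_mono gauss_cdf_mono) gtrBl.
Qed.

Lemma measurable_gauss_cdf : measurable_fun [set: R] Phi.
Proof. by apply: nondecreasing_measurable => // x y; exact: gauss_cdf_homo. Qed.

(** The probability integral transform: it is what allows all the estimates
    below to be made on uniform variables, with no Gaussian asymptotics for
    the individual order statistics. *)
Lemma gauss_cdf_uniform u : 0 <= u <= 1 -> P [set x | Phi x <= u] = u%:E.
Proof.
move=> /andP[]; rewrite le_eqVlt => /predU1P[<- _|u0].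
  rewrite (_ : [set x | _] = set0) ?measure0//.
  by apply/seteqP; split => // x /=; rewrite leNgt gauss_cdf_gt0.
rewrite le_eqVlt => /predU1P[->|u1].
  rewrite (_ : [set x | _] = setT) ?probability_setT//.
  by apply/seteqP; split => // x _ /=; exact: gauss_cdf_le1.
have [|t <-] := @gauss_quantile u; first by rewrite u0.
rewrite -gauss_cdfE; congr P; apply/seteqP.
by split => x /=; rewrite gauss_cdf_mono in_itv.
Qed.

Lemma measurable_gauss_cdf_le u : measurable [set x | Phi x <= u].
Proof.
have := measurable_gauss_cdf measurableT (measurable_itv `]-oo, u]).
by rewrite setTI.
Qed.

Let itv_setD u v :
  [set x | u < Phi x <= v] = [set x | Phi x <= v] `\` [set x | Phi x <= u].
Proof.
apply/seteqP; split => x /=.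
  by move=> /andP[ux xv]; split => //; apply/negP; rewrite -ltNge.
by move=> [xv /negP]; rewrite -ltNge => ->.
Qed.

Lemma measurable_gauss_cdf_itv u v : measurable [set x | u < Phi x <= v].
Proof.
by rewrite itv_setD; apply: measurableD; exact: measurable_gauss_cdf_le.
Qed.

Lemma gauss_cdf_uniform_itv u v : 0 <= u -> u <= v -> v <= 1 ->
  P [set x | u < Phi x <= v] = (v - u)%:E.
Proof.
move=> u0 uv v1; rewrite itv_setD.
have mu := measurable_gauss_cdf_le u; have mv := measurable_gauss_cdf_le v.
rewrite measureD//=; last by rewrite ltey_eq fin_num_measure.
rewrite setIidr; last by move=> x /= /le_trans; exact.
by rewrite !gauss_cdf_uniform ?u0 ?v1 ?(le_trans u0) ?(le_trans uv).
Qed.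

Lemma is_derive_gauss_density x : is_derive x 1 phi (- x * phi x).
Proof.
have h : is_derive x 1 (fun x => - (x ^+ 2 / 2)) (- x).
  by apply: is_derive_eq; rewrite /GRing.scale/=; field.
apply: is_derive_eq; rewrite /phi /GRing.scale/=; ring.
Qed.

(** On the left of [-1] one has [phi <= phi'], so [phi - Phi] increases there;
    its limit at minus infinity is nonnegative. *)
Lemma gauss_cdf_tail t : t <= -1 -> Phi t <= phi t.
Proof.
move=> t1; apply/ler_addgt0Pr => e e0.
have /cvgr_lt/(_ _ e0) H := cvg_gauss_cdfNy0.
have [s [Hs st]] : exists s, Phi s < e /\ s <= t.
  near (ninfty_nbhs R) => s; exists s; split; near: s => //.
  by apply: nbhs_ninfty_le; rewrite num_real.
have : phi s - Phi s <= phi t - Phi t.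
  apply: (@le_of_derive_ge0 (fun x => phi x - Phi x)
    (fun x => - x * phi x - phi x) s t st).
    move=> x; apply: is_deriveB => //; first exact: is_derive_gauss_density.
    exact: is_derive_gauss_cdf.
  move=> x /andP[_ xt].
  have -> : - x * phi x - phi x = (- x - 1) * phi x by ring.
  by rewrite mulr_ge0 ?(ltW (gauss_density_gt0 _))//; lra.
have := gauss_density_gt0 s; lra.
Unshelve. all: by end_near. Qed.

(** A lower bound of Mills type, [phi / Phi <= (y + e) / (1 - small)].  For
    [u] in [[0, e]] one has [phi (t - u) >= phi t * exp (- (y + e) * u)];
    integrating in [u] bounds [Phi t - Phi (t - e)] from below.  The
    integration is carried out by comparing derivatives in [u]. *)
Lemma mills_lower (y e t : R) : 0 < y -> 0 < e -> - y <= t ->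
  phi t * (1 - expR (- ((y + e) * e))) <= (y + e) * Phi t.
Proof.
move=> y0 e0 yt; pose L : R := y + e; have L0 : 0 < L by rewrite /L addr_gt0.
rewrite -/L.
pose g (u : R) : R := phi t * expR (- (L * u)) - L * Phi (t - u).
pose dg (u : R) : R := - (L * phi t) * expR (- (L * u)) + L * phi (t - u).
suff : g 0 <= g e.
  rewrite /g mulr0 oppr0 expR0 addr0 => H.
  have := mulr_ge0 (ltW L0) (gauss_cdf_ge0 (t - e)); lra.
apply: (@le_of_derive_ge0 g dg 0 e (ltW e0)).
  move=> u; rewrite /g /dg.
  have h : is_derive u 1 (fun u => - (L * u)) (- L).
    by apply: is_derive_eq; rewrite /GRing.scale/=; ring.
  have h' : is_derive u 1 (fun u => t - u) (- 1).
    by apply: is_derive_eq; rewrite add0r mul1r.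
  have h2 : is_derive u 1 (fun u => Phi (t - u)) (- phi (t - u)).
    rewrite -mulrN1; apply: (@is_derive1_comp _ Phi (fun u => t - u)) => //.
    exact: is_derive_gauss_cdf.
  by apply: is_derive_eq; rewrite /GRing.scale/=; ring.
move=> u /andP[u0 ue]; rewrite /dg.
suff H : phi t * expR (- (L * u)) <= phi (t - u).
  by have := ler_wpM2l (ltW L0) H; lra.
rewrite /phi -mulrA -expRD ler_wpM2l ?normal_peak_ge0// ler_expR.
rewrite /L; nra.
Qed.

Lemma gauss_density_le t : phi t <= expR (- (t ^+ 2 / 2)).
Proof.
rewrite /phi ler_piMl ?expR_ge0// /normal_peak.
rewrite expr1n mul1r; have pi2 : 1 <= pi *+ 2 :> R by have := @pi_ge2 R; lra.
have pi2_gt0 : 0 < pi *+ 2 :> R by exact: lt_le_trans pi2.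
by rewrite invf_le1 ?sqrtr_gt0// -[X in X <= _]sqrtr1 ler_sqrt// ltW.
Qed.

(** The hazard rate [phi / Phi] is at most [lam] on the right of [- y], so
    [exp (- lam * x) * Phi x] decreases there.  Thus [Phi] grows at most like
    an exponential of rate [lam], and a large ratio [Phi t / Phi s] forces a
    large gap [t - s]. *)
Lemma gauss_cdf_growth (lam y e s t : R) : 0 < y -> 0 < e ->
  y + e <= lam * (1 - expR (- ((y + e) * e))) ->
  - y <= s -> s <= t ->
  Phi t <= expR (lam * (t - s)) * Phi s.
Proof.
move=> y0 e0 hlam ys st.
pose E := expR (- ((y + e) * e)).
have E1 : 0 < 1 - E.
  by rewrite subr_gt0 expR_lt1 oppr_lt0 mulr_gt0 ?addr_gt0.
have hazard x : - y <= x -> phi x <= lam * Phi x.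
  move=> yx; rewrite -(ler_pM2r E1) (le_trans (mills_lower y0 e0 yx))//.
  by rewrite mulrAC ler_wpM2r ?gauss_cdf_ge0.
have : - expR (- (lam * s)) * Phi s <= - expR (- (lam * t)) * Phi t.
  pose dg x := lam * expR (- (lam * x)) * Phi x - expR (- (lam * x)) * phi x.
  apply: (@le_of_derive_ge0 (fun x => - expR (- (lam * x)) * Phi x) dg s t st).
    move=> x; rewrite /dg.
    have h : is_derive x 1 (fun u => - (lam * u)) (- lam).
      by apply: is_derive_eq; rewrite /GRing.scale/=; ring.
    have h2 := is_derive_gauss_cdf x.
    by apply: is_derive_eq; rewrite /GRing.scale/=; ring.
  move=> x /andP[sx _]; rewrite /dg [lam * _]mulrC -mulrA -mulrBr.
  by rewrite mulr_ge0 ?expR_ge0// subr_ge0 hazard// ltW// (le_lt_trans ys).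
rewrite mulNr mulNr lerN2 -(ler_pM2l (expR_gt0 (lam * t))) !mulrA -!expRD.
rewrite subrr expR0 mul1r => /le_trans; apply.
by rewrite mulrBr.
Qed.

End gaussian.

(** * Outer bounds on probabilities and the Borel-Cantelli lemma *)

Lemma sum_inv_sqr_le (R : realFieldType) m :
  \sum_(0 <= N < m) (N%:R ^+ 2)^-1 <= 2 :> R.
Proof.
have step k : \sum_(0 <= N < k.+2) (N%:R ^+ 2)^-1 <= 2 - k.+1%:R^-1 :> R.
  elim: k => [|k IH].
    by rewrite big_nat_recr//= big_nat1 expr0n/= invr0 expr1n invr1; lra.
  rewrite big_nat_recr//= (le_trans (lerD IH (lexx _)))//.
  have lin (a b c : R) : c <= a - b -> 2 - a + c <= 2 - b by lra.
  apply: lin.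
  have -> : k.+1%:R^-1 - k.+2%:R^-1 = (k.+1%:R * k.+2%:R)^-1 :> R.
    rewrite -[k.+2%:R]natr1; have : 0 < k.+1%:R :> R by [].
    by move: k.+1%:R => x x0; field; rewrite !gt_eqF// ltr_wpDr.
  rewrite lef_pV2 ?posrE ?exprn_gt0 ?mulr_gt0 ?ltr0n// expr2.
  by rewrite ler_wpM2r// ler_nat.
case: m => [|[|m]].
- by rewrite big_geq.
- by rewrite big_nat1 expr0n invr0.
- by rewrite (le_trans (step m))// lerBlDr lerDl invr_ge0.
Qed.

Section outer_bounds.
Context {R : realType} {d} {T : measurableType d} (P : probability T R).

(** [B] has outer probability at most [c].  Working with outer bounds lets the
    bad events be handled without proving each of them measurable. *)
Definition prob_le (B : set T) (c : R) :=
  exists A, [/\ measurable A, B `<=` A & (P A <= c%:E)%E].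

Lemma prob_leS (A B : set T) (a b : R) :
  B `<=` A -> a <= b -> prob_le A a -> prob_le B b.
Proof.
move=> BA ab [A' [mA' AA' A'a]]; exists A'; split => //.
  exact: subset_trans AA'.
by rewrite (le_trans A'a)// lee_fin.
Qed.

Lemma prob_le0 : prob_le set0 0.
Proof. by exists set0; rewrite measure0; split. Qed.

Lemma prob_leU (A B : set T) (a b : R) :
  prob_le A a -> prob_le B b -> prob_le (A `|` B) (a + b).
Proof.
move=> [A' [mA AA Aa]] [B' [mB BB Bb]]; exists (A' `|` B'); split.
- exact: measurableU.
- exact: setUSS.
- by rewrite (le_trans (measureU2 _ _ _))// EFinD leeD.
Qed.

Lemma prob_le_exists (I : finType) (S : pred I) (B : I -> set T) (c : I -> R) :
  (forall i, S i -> prob_le (B i) (c i)) ->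
  prob_le [set w | exists i, S i /\ B i w] (\sum_(i | S i) c i).
Proof.
move=> Bc.
suff H : prob_le (\big[setU/set0]_(i | S i) B i) (\sum_(i | S i) c i).
  apply: prob_leS (lexx _) H => w [i [Si Bi]].
  by rewrite (bigD1 i)//=; left.
apply: (big_ind2 prob_le) => //; first exact: prob_le0.
by move=> A a B' b; exact: prob_leU.
Qed.

(** The first Borel-Cantelli lemma for a bound of order [N ^ -2], to which all
    the estimates are reduced. *)
Lemma borel_cantelli_sqr (E : nat -> set T) (c : R) (N0 : nat) :
  (forall N, (N0 <= N)%N -> prob_le (E N) (c / N%:R ^+ 2)) ->
  {ae P, forall w, \forall N \near \oo, ~ E N w}.
Proof.
move=> Ec.
have /choice[A HA] N : exists A, [/\ measurable A,
    (N0 <= N)%N -> E N `<=` A & (P A <= (`|c| / N%:R ^+ 2)%:E)%E].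
  have [/Ec[A [mA EA PA]]|] := leqP N0 N.
    exists A; split => //; rewrite (le_trans PA)// lee_fin.
    by rewrite ler_wpM2r ?ler_norm// invr_ge0.
  move=> _; exists set0; split; [by []|by []|].
  by rewrite measure0 lee_fin divr_ge0.
have mA N : measurable (A N) by case: (HA N).
have PA : P (lim_sup_set A) = 0%E.
  apply: lim_sup_set_cvg0 => //.
  apply: (@le_lt_trans _ _ (`|c| * 2)%:E); last exact: ltry.
  apply: lime_le; first by apply: is_cvg_nneseries.
  near=> m.
  apply: (@le_trans _ _ (\sum_(0 <= N < m) (`|c| / N%:R ^+ 2)%:E)%E).
    by apply: lee_sum => N _; case: (HA N).
  by rewrite sumEFin lee_fin -mulr_sumr ler_wpM2l// sum_inv_sqr_le.
exists (lim_sup_set A); split => //.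
  by apply: bigcap_measurableType => n _; apply: bigcup_measurable => N _.
move=> w /= nE n _ /=; apply: contrapT => nA; apply: nE.
exists (maxn n N0) => // N /=; rewrite geq_max => /andP[nN N0N] ENw.
by apply: nA; exists N => //; case: (HA N) => _ /(_ N0N)/(_ _ ENw).
Unshelve. all: by end_near. Qed.

End outer_bounds.

(** * Independent Gaussian variables *)

Section iid_gaussian.
Context {R : realType} {d} {T : measurableType d} {P : probability T R}.
Context {n : nat} (X : 'I_n -> {RV P >-> R}).
Hypothesis X_iid : iid_standard_gaussian X.

Local Notation Phi := gauss_cdf.

Let X_law i (B : set R) : measurable B -> P (X i @^-1` B) = normal_prob 0 1 B.
Proof. by move=> mB; rewrite -(X_iid.2 i B mB). Qed.

Let prob_le_all (J : {set 'I_n}) (B : set R) (p : R) : measurable B ->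
  normal_prob 0 1 B = p%:E ->
  prob_le P [set w | forall i, i \in J -> B (X i w)] (p ^+ #|J|).
Proof.
move=> mB Bp; exists (\bigcap_(i in [set` J]) (X i @^-1` B)); split.
- by apply: fin_bigcap_measurable => // i _; exact: measurable_funPTI.
- by move=> w h i /= /h.
rewrite (X_iid.1 J (fun=> B))//.
under eq_bigr do rewrite X_law// Bp.
by rewrite prodEFin prodr_const.
Qed.

Lemma prob_le_all_cdf_gt (u : R) : 0 <= u <= 1 ->
  prob_le P [set w | forall i, u < Phi (X i w)] (expR (- (n%:R * u))).
Proof.
move=> /andP[u0 u1].
have := prob_le_all [set: 'I_n]%SET (measurable_gauss_cdf_itv u 1)
  (gauss_cdf_uniform_itv u0 u1 (lexx _)).
apply: prob_leS.
  by move=> w /= h i _; rewrite h gauss_cdf_le1.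
rewrite cardsT card_ord expRN expRM_natl -exprVn -expRN.
rewrite lerXn2r ?nnegrE ?subr_ge0 ?expR_ge0//.
exact: expR_ge1Dx.
Qed.

(** Union bound over the index sets of size [k]: by independence all the
    uniform variables of such a set are below [u] with probability
    [u ^ k]. *)
Lemma prob_le_card_cdf_le (k : nat) (u : R) : 0 <= u <= 1 ->
  prob_le P [set w | (k <= #|[pred i | (Phi (X i w) <= u)%R]|)%N]
    ('C(n, k)%:R * u ^+ k).
Proof.
move=> u01.
have H (J : {set 'I_n}) : #|J| == k ->
    prob_le P [set w | forall i, i \in J -> Phi (X i w) <= u] (u ^+ k).
  move=> /eqP <-.
  exact: prob_le_all (measurable_gauss_cdf_le u) (gauss_cdf_uniform u01).
have := prob_le_exists H.
apply: prob_leS.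
  move=> w /= /card_geqP[s [us sk sP]]; exists [set i in s]%SET; split.
    by rewrite cardsE (card_uniqP us) sk.
  by move=> i; rewrite inE => /sP.
have := card_draws 'I_n k; rewrite card_ord cardsE => <-.
by rewrite sumr_const mulr_natl.
Qed.

Lemma prob_le_exists_le (t : R) :
  prob_le P [set w | exists i, X i w <= t] (n%:R * Phi t).
Proof.
have H (i : 'I_n) : true -> prob_le P [set w | X i w <= t] (Phi t).
  move=> _; exists (X i @^-1` `]-oo, t]); split.
  - exact: measurable_funPTI.
  - by move=> w /=; rewrite in_itv.
  - by rewrite X_law// gauss_cdfE.
have := prob_le_exists H.
apply: prob_leS; first by move=> w /= [i]; exists i.
by rewrite sumr_const card_ord mulr_natl.
Qed.

(** Two values that coincide fall in the same of the [m] cells of equal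
    probability [1 / m], an event of probability at most
    [m * (1 / m) ^ 2 = 1 / m] for each of the at most [n ^ 2] pairs. *)
Lemma prob_le_tie (m : nat) : (0 < m)%N ->
  prob_le P [set w | exists i j, i != j /\ X i w = X j w] (n%:R ^+ 2 / m%:R).
Proof.
move=> m0.
pose c l : R := l%:R / m%:R.
have cP l : (l < m)%N ->
    [/\ 0 <= c l, c l <= c l.+1, c l.+1 <= 1 & c l.+1 - c l = m%:R^-1].
  move=> lm; rewrite /c; split.
  - by rewrite divr_ge0.
  - by rewrite ler_wpM2r ?invr_ge0// ler_nat.
  - by rewrite ler_pdivrMr ?ltr0n// mul1r ler_nat.
  - by rewrite -mulrBl -natrB// subSnn mul1r.
have H (ij : 'I_n * 'I_n) : ij.1 != ij.2 ->
    prob_le P [set w | X ij.1 w = X ij.2 w] m%:R^-1.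
  case: ij => i j /= ij.
  have Hl (l : 'I_m) : true ->
      prob_le P [set w | forall k, k \in [set i; j]%SET ->
        c l < Phi (X k w) <= c l.+1] (m%:R^-1 ^+ 2).
    move=> _; have [h1 h2 h3 h4] := cP l (ltn_ord l).
    rewrite -h4.
    have := prob_le_all [set i; j]%SET
      (measurable_gauss_cdf_itv (c l) (c l.+1))
      (gauss_cdf_uniform_itv h1 h2 h3).
    by rewrite cards2 ij.
  have := prob_le_exists Hl; apply: prob_leS.
    move=> w /= Xij.
    have ex : exists l, Phi (X i w) <= c l.+1.
      exists m.-1; rewrite prednK// /c divff ?gauss_cdf_le1//.
      by rewrite pnatr_eq0 -lt0n.
    case: (ex_minnP ex) => l hl lmin.
    have lm : (l < m)%N.
      rewrite -(prednK m0) ltnS lmin// prednK// /c divff ?gauss_cdf_le1//.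
      by rewrite pnatr_eq0 -lt0n.
    exists (Ordinal lm); split => // k /=.
    rewrite !inE => kij; have -> : X k w = X i w.
      by move: kij => /orP[] /eqP ->.
    rewrite hl andbT; case: l hl lmin lm => [|l] hl lmin lm.
      by rewrite /c mul0r gauss_cdf_gt0.
    by rewrite ltNge; apply/negP => /lmin; rewrite ltnn.
  rewrite sumr_const card_ord -[leLHS]mulr_natr expr2 -mulrA mulVf ?mulr1//.
  by rewrite pnatr_eq0 -lt0n.
have := prob_le_exists H; apply: prob_leS.
  by move=> w [i [j [ij Xij]]]; exists (i, j).
rewrite sumr_const -[leLHS]mulr_natl ler_wpM2r ?invr_ge0//.
rewrite -natrX ler_nat (leq_trans (max_card _))//.
by rewrite card_prod card_ord.
Qed.

End iid_gaussian.

(** * Real analysis *)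

Section real_analysis.
Context {R : realType}.
Implicit Types a b c q r s x z : R.

Lemma expRN_le_sqr x : 0 < x -> expR (- x) <= 2 / x ^+ 2.
Proof.
move=> x0; rewrite expRN -[leRHS]invrK lef_pV2 ?posrE ?expR_gt0//; last first.
  by rewrite invr_gt0 divr_gt0// exprn_gt0.
rewrite invf_div; apply: le_trans (expR_ge1Dxn 1 (ltW x0)).
by rewrite lerDr.
Qed.

(** Since ['C(n, k) <= n ^ k / k!] and [k ^ k / k! <= e ^ k], the left-hand
    side is at most [(e * c) ^ k] for [c = 1 / (2 * e)]. *)
Lemma bin_pow_le (n k : nat) : (0 < n)%N ->
  'C(n, k)%:R * (expR (- 1) / 2 * k%:R / n%:R) ^+ k <= 2^-1 ^+ k :> R.
Proof.
move=> n0; case: k => [|k]; first by rewrite bin0 !expr0 mulr1.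
set m := k.+1.
have fac0 : 0 < m`!%:R :> R by rewrite ltr0n fact_gt0.
have ffact_le j : (n ^_ j <= n ^ j)%N.
  elim: j => [|j IH]; first by rewrite ffactn0.
  by rewrite ffactnSr expnSr leq_mul// leq_subr.
have binE : 'C(n, m)%:R <= n%:R ^+ m / m`!%:R :> R.
  by rewrite ler_pdivlMr// -natrM bin_ffact -natrX ler_nat.
have powE : m%:R ^+ m / m`!%:R <= expR 1 ^+ m :> R.
  rewrite -expRM_natl mulr1; apply: le_trans (expR_ge1Dxn k (ler0n _ _)).
  by rewrite lerDr.
have n0R : 0 < n%:R :> R by rewrite ltr0n.
have base_ge0 : 0 <= expR (- 1) / 2 * m%:R / n%:R :> R.
  by rewrite !mulr_ge0 ?invr_ge0 ?expR_ge0.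
apply: le_trans (ler_wpM2r (exprn_ge0 m base_ge0) binE) _.
have -> : n%:R ^+ m / m`!%:R * (expR (- 1) / 2 * m%:R / n%:R) ^+ m =
    (m%:R ^+ m / m`!%:R) * (expR (- 1) / 2) ^+ m :> R.
  rewrite 2!exprMn [n%:R^-1 ^+ m]exprVn.
  have : n%:R ^+ m != 0 :> R by rewrite expf_neq0// gt_eqF.
  move: (n%:R ^+ m) (m%:R ^+ m) ((_ / _) ^+ m) => A B C A0.
  by field; rewrite A0 gt_eqF.
apply: le_trans (ler_wpM2r _ powE) _.
  by rewrite exprn_ge0// divr_ge0 ?expR_ge0.
by rewrite -exprMn mulrA expRxMexpNx_1 mul1r.
Qed.

Lemma sum_half_le (K n : nat) :
  \sum_(k < n | (K < k)%N) 2^-1 ^+ k <= 2^-1 ^+ K :> R.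
Proof.
rewrite (_ : \sum_(k < n | _) _ = \sum_(K.+1 <= k < n) 2^-1 ^+ k); last first.
  by rewrite big_geq_mkord.
have partial m : (K <= m)%N ->
    \sum_(K.+1 <= k < m.+1) 2^-1 ^+ k <= 2^-1 ^+ K - 2^-1 ^+ m :> R.
  elim: m => [|m IH].
    by rewrite leqn0 => /eqP ->; rewrite big_geq// subrr.
  rewrite leq_eqVlt => /predU1P[->|]; first by rewrite big_geq// subrr.
  rewrite ltnS => Km; rewrite big_nat_recr//=.
  rewrite (le_trans (lerD (IH Km) (lexx _)))// [2^-1 ^+ m.+1]exprS; lra.
have [nK|] := leqP n K; first by rewrite big_geq ?exprn_ge0// ltnW.
case: n => // n; rewrite ltnS => /partial/le_trans; apply.
by rewrite gerBl exprn_ge0.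
Qed.

(** Telescoping majorant of the terms of a Riemann series.  It amounts to
    [1 + q / (k + 1) <= ((k + 1) / k) ^ q], which follows from
    [1 + z <= exp z] used twice, for [z = q / (k + 1)] and for
    [z = - 1 / (k + 1)]. *)
Lemma pow_tail_term q (k : nat) : 0 < q -> (0 < k)%N ->
  k.+1%:R `^ (- (q + 1)) <= (k%:R `^ (- q) - k.+1%:R `^ (- q)) / q :> R.
Proof.
move=> q0 k0; have k1 : 0 < k.+1%:R :> R by [].
have kR : 0 < k%:R :> R by rewrite ltr0n.
rewrite ler_pdivlMr// opprD powRD; last by rewrite (gt_eqF k1) implybT.
rewrite powR_inv1// -mulrA.
suff : (1 + q / k.+1%:R) * k.+1%:R `^ (- q) <= k%:R `^ (- q) :> R.
  by rewrite mulrDl mul1r lerBrDl [q / _]mulrC [_^-1 * q * _]mulrC.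
have base : expR k.+1%:R^-1 <= k.+1%:R / k%:R :> R.
  rewrite -[leLHS]invrK -expRN -[leRHS]invrK lef_pV2 ?posrE ?expR_gt0//;
    last by rewrite invr_gt0 divr_gt0.
  rewrite invf_div; apply: le_trans (expR_ge1Dx _).
  rewrite ler_pdivrMr// mulrDl mulNr mulVf ?gt_eqF// mul1r -natr1.
  by rewrite addrK.
rewrite 2!powRN ler_pdivrMr ?powR_gt0// (le_trans (expR_ge1Dx _))//.
have -> : (k%:R `^ q)^-1 * k.+1%:R `^ q = (k.+1%:R / k%:R) `^ q :> R.
  rewrite powRM ?invr_ge0// -[k%:R^-1]powR_inv1// powRAC powR_inv1 ?powR_ge0//.
  by rewrite mulrC.
rewrite [q / _]mulrC expRM ge0_ler_powR ?nnegrE ?expR_ge0 ?divr_ge0//.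
exact: ltW.
Qed.

Lemma pow_tail_sum q (K n : nat) : 0 < q -> (0 < K)%N ->
  \sum_(k < n | (K <= k)%N) k.+1%:R `^ (- (q + 1)) <= K%:R `^ (- q) / q :> R.
Proof.
move=> q0 K0.
rewrite (_ : \sum_(k < n | _) _ = \sum_(K <= k < n) k.+1%:R `^ (- (q + 1)));
  last by rewrite big_geq_mkord.
have [nK|Kn] := leqP n K; first by rewrite big_geq// divr_ge0 ?powR_ge0// ltW.
rewrite big_nat; apply: (@le_trans _ _
    (\sum_(K <= k < n) (k%:R `^ (- q) - k.+1%:R `^ (- q)) / q)).
  rewrite [leRHS]big_nat; apply: ler_sum => k /andP[Kk _].
  by rewrite pow_tail_term// (leq_trans K0).
rewrite -mulr_suml ler_wpM2r ?invr_ge0 ?(ltW q0)//.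
rewrite (telescope_sumr_eq (fun k => - (k%:R `^ (- q)))) ?(ltnW Kn)//;
  last first.
  by move=> k _; rewrite opprK addrC.
by rewrite opprK gerDr oppr_le0 powR_ge0.
Qed.

Lemma expRN_le_powR r s z : 0 < r -> 0 <= s -> r <= expR z ->
  expR (- (s * z)) <= r `^ (- s).
Proof.
move=> r0 s0 rz; rewrite expRN powRN lef_pV2 ?posrE ?expR_gt0 ?powR_gt0//.
by rewrite mulrC expRM ge0_ler_powR// nnegrE ltW// expR_gt0.
Qed.

Lemma near_ln_powR_le c s k : 0 < c -> 0 < s -> 0 < k ->
  \forall N \near \oo, (c * ln N%:R) `^ s <= N%:R `^ k :> R.
Proof.
(* One power N ^ e bounds ln N up to a constant, another one absorbs the
   constants; the exponent s turns N ^ (2 * e) into N ^ k. *)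
move=> c0 s0 k0; pose e := k / s / 2.
have e0 : 0 < e by rewrite !divr_gt0.
near=> N.
have N1 : 1 <= N%:R :> R by rewrite ler1n; near: N; exact: nbhs_infty_gt.
have N0 : 0 < N%:R :> R by exact: lt_le_trans N1.
have cN : c / e <= N%:R `^ e.
  have -> : c / e = ((c / e) `^ e^-1) `^ e.
    by rewrite -powRrM mulVf ?gt_eqF// powRr1// divr_ge0// ltW.
  rewrite ge0_ler_powR ?nnegrE ?powR_ge0 ?(ltW e0) ?(ltW N0)//.
  by near: N; exact: nbhs_infty_ger.
have lnN : ln N%:R <= N%:R `^ e / e.
  rewrite ler_pdivlMr// mulrC -ln_powR ltW// ln_sublinear// powR_gt0//.
have -> : k = (e + e) * s by rewrite /e; field; rewrite gt_eqF.
rewrite powRrM ge0_ler_powR ?nnegrE ?powR_ge0 ?(ltW s0)//.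
  by rewrite mulr_ge0 ?(ltW c0) ?ln_ge0.
rewrite powRD; last by rewrite (gt_eqF N0) implybT.
apply: le_trans (_ : c * (N%:R `^ e / e) <= _); first by rewrite ler_pM2l.
by rewrite mulrCA [leLHS]mulrC mulrC ler_pM2l ?powR_gt0// mulrC.
Unshelve. all: by end_near. Qed.

(** Room for the three factors [t] lost in [order_weight_le]: the exponent
    [b / t ^ 3] still exceeds [(b + 1) / 2]. *)
Lemma exists_cube_lt b : 1 < b -> exists2 t, 1 < t & t ^+ 3 * (b + 1) < 2 * b.
Proof.
move=> b1; pose e := (b - 1) / (14 * (b + 1)).
have e0 : 0 < e by rewrite divr_gt0// ?subr_gt0// mulr_gt0//; lra.
have eE : e * (b + 1) = (b - 1) / 14.
  by rewrite /e; field; rewrite gt_eqF//; lra.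
exists (1 + e); first lra.
have e1 : e <= 1 by nra.
have : (1 + e) ^+ 3 <= 1 + 7 * e by nra.
nra.
Qed.

End real_analysis.

(** * Typical disorder *)

Section spread_levels.
Context {R : realType}.
Local Notation Phi := gauss_cdf.

(** The minimum of [2 ^ N] independent standard Gaussian variables is close to
    [- edge N]. *)
Definition edge N : R := Num.sqrt (2 * ln (2 ^+ N)).

(** The factor [1 / (2 e)] makes it exponentially unlikely, in [k], that [k] of
    [2 ^ N] uniform variables lie below this level; on average only
    [k / (2 e)] of them do. *)
Definition level N k : R := expR (- 1) / 2 * k%:R / (2 ^ N)%N%:R.

(** The typical behaviour of the disorder, expressed through the uniform
    variables [Phi (x i)]: no ties, no value much below the edge, a minimum of
    order at most [ln N / 2 ^ N], and a [k]-th smallest value of order at least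
    [k / 2 ^ N] for all [k] beyond the truncation.  The last bound is stated
    only for [k > K] because small [k] would not give summable
    probabilities. *)
Definition spread N K (t : R) (x : 'I_(2 ^ N)%N -> R) : Prop :=
  [/\ injective x,
      forall i, - (t * edge N) < x i,
      exists i, Phi (x i) <= 2 * ln N%:R / (2 ^ N)%N%:R &
      forall k, (K < k <= 2 ^ N)%N ->
        (#|[pred i | (Phi (x i) <= level N k)%R]| < k)%N].

Lemma edge_ge0 N : 0 <= edge N. Proof. exact: sqrtr_ge0. Qed.

Lemma edge_sqr N : edge N ^+ 2 = 2 * (N%:R * ln 2).
Proof.
rewrite sqr_sqrtr ?mulr_ge0 ?ln_ge0 ?exprn_ege1 ?ler1n//.
by rewrite lnXn// [N%:R * _]mulr_natl.
Qed.

Lemma level_itv01 N k : (k <= 2 ^ N)%N -> 0 <= level N k <= 1.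
Proof.
move=> kn; rewrite /level; have e1 : expR (- 1) <= 1 :> R by rewrite expR_le1.
have e0 := expR_ge0 (- 1 : R).
rewrite !mulr_ge0 ?invr_ge0//= ler_pdivrMr ?ltr0n ?expn_gt0// mul1r.
apply: (@le_trans _ _ k%:R); last by rewrite ler_nat.
by rewrite ler_piMl//; lra.
Qed.

Section proba.
Context {d} {T : measurableType d} {P : probability T R}.
Context {N : nat} (X : 'I_(2 ^ N)%N -> {RV P >-> R}).
Hypothesis X_iid : iid_standard_gaussian X.

(** The four ways to fail have probabilities at most of order [N ^ -2], [exp (- c * N)],
    [N ^ -2] and [2 ^ - K]; the last one is exponentially small in [N] because
    [N <= K]. *)
Lemma prob_le_not_spread K (t : R) : (1 <= N <= K)%N -> 1 < t ->
  1 <= t * edge N ->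
  prob_le P [set w | ~ spread K t (fun i => X i w)]
    ((2 + 2 / ((t ^+ 2 - 1) * ln 2) ^+ 2 + 2 / ln 2 ^+ 2) / N%:R ^+ 2).
Proof.
move=> /andP[N0 NK] t1 tedge.
have NR : 0 < N%:R :> R by rewrite ltr0n.
have n0 : (0 < 2 ^ N)%N by rewrite expn_gt0.
have nR : 0 < (2 ^ N)%N%:R :> R by rewrite ltr0n.
have ln2 : 0 < ln 2 :> R by rewrite ln_gt0// ltr1n.
(* The number of cells is chosen so that the union bound over pairs gives
   exactly 1 / N ^ 2. *)
have m0 : (0 < (2 ^ N) ^ 2 * N ^ 2)%N by rewrite muln_gt0 !expn_gt0 N0.
have tie := prob_le_tie X_iid m0.
have low := prob_le_exists_le X_iid (- (t * edge N)).
have u01 : 0 <= 2 * ln (N%:R : R) / (2 ^ N)%N%:R <= 1.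
  rewrite divr_ge0 ?mulr_ge0 ?ln_ge0 ?ler1n//= ler_pdivrMr// mul1r.
  apply: (@le_trans _ _ (2 * N%:R)).
    by rewrite ler_pM2l// ltW// ln_sublinear.
  rewrite -natrM ler_nat; case: N N0 => // m _.
  by rewrite expnS leq_pmul2l// ltn_expl.
have high := prob_le_all_cdf_gt X_iid u01.
have many := @prob_le_exists _ _ _ P 'I_(2 ^ N).+1 (fun k => (K < k)%N) _ _
  (fun k Kk => prob_le_card_cdf_le X_iid k (level_itv01 (ltn_ord k))).
have := prob_leU (prob_leU tie low) (prob_leU high many).
apply: prob_leS.
  move=> w /= nspread; apply: contrapT => nbad; apply: nspread; split.
  - move=> i j Xij; apply: contrapT => ij; apply: nbad; left; left.
    by exists i, j; split => //; apply/eqP.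
  - move=> i; rewrite ltNge; apply/negP => Xi; apply: nbad; left; right.
    by exists i.
  - apply: contrapT => nex; apply: nbad; right; left => i.
    by rewrite ltNge; apply/negP => Xi; apply: nex; exists i.
  - move=> k /andP[Kk kn]; rewrite ltnNge; apply/negP => kX; apply: nbad.
    have kn' : (k < (2 ^ N).+1)%N by rewrite ltnS.
    by right; right; exists (Ordinal kn').
have h1 : (2 ^ N)%N%:R ^+ 2 / ((2 ^ N) ^ 2 * N ^ 2)%N%:R <= 1 / N%:R ^+ 2 :> R.
  by rewrite natrM !natrX invfM mulrA divff ?expf_neq0 ?gt_eqF.
have h2 : (2 ^ N)%N%:R * Phi (- (t * edge N)) <=
    2 / ((t ^+ 2 - 1) * ln 2) ^+ 2 / N%:R ^+ 2 :> R.
  apply: le_trans (ler_wpM2l (ltW nR) (gauss_cdf_tail _)) _.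
    by rewrite lerN2.
  apply: le_trans (ler_wpM2l (ltW nR) (gauss_density_le _)) _.
  have -> : (2 ^ N)%N%:R = expR (N%:R * ln 2) :> R.
    by rewrite expRM_natl lnK ?posrE// natrX.
  rewrite -expRD sqrrN exprMn edge_sqr.
  have -> : N%:R * ln 2 - t ^+ 2 * (2 * (N%:R * ln 2)) / 2 =
    - ((t ^+ 2 - 1) * ln 2 * N%:R) :> R by field.
  apply: le_trans (expRN_le_sqr _) _.
    by rewrite !mulr_gt0// subr_gt0 expr_gt1 ?ltW// (le_lt_trans _ t1).
  by rewrite [_ ^+ 2]exprMn invfM mulrA.
have h3 : expR (- ((2 ^ N)%N%:R * (2 * ln N%:R / (2 ^ N)%N%:R))) <=
    1 / N%:R ^+ 2 :> R.
  rewrite mulrCA divff ?gt_eqF// mulr1 expRN expRM_natl lnK ?posrE//.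
  by rewrite div1r.
have h4 : \sum_(k < (2 ^ N).+1 | (K < k)%N) 'C(2 ^ N, k)%:R * level N k ^+ k <=
    2 / ln 2 ^+ 2 / N%:R ^+ 2 :> R.
  apply: (@le_trans _ _ (\sum_(k < (2 ^ N).+1 | (K < k)%N) 2^-1 ^+ k)).
    by apply: ler_sum => k _; exact: bin_pow_le.
  apply: le_trans (sum_half_le _ _) _.
  apply: (@le_trans _ _ (2^-1 ^+ N)).
    by rewrite ler_wiXn2l// invf_le1// ler1n.
  have -> : 2^-1 ^+ N = expR (- (ln 2 * N%:R)) :> R.
    by rewrite expRN expRM_natr lnK ?posrE// exprVn.
  apply: le_trans (expRN_le_sqr _) _; first by rewrite mulr_gt0.
  by rewrite exprMn invfM mulrA.
rewrite [leRHS]mulrDl [X in _ <= X + _]mulrDl.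
have -> : 2 / N%:R ^+ 2 = 1 / N%:R ^+ 2 + 1 / N%:R ^+ 2 :> R.
  by rewrite -mulrDl -natr1.
apply: le_trans (lerD (lerD h1 h2) (lerD h3 h4)) _.
by rewrite addrACA addrA.
Qed.

End proba.

(** Between the minimum and the [j]-th order statistic [Phi] is multiplied by
    at least a constant times [(j + 1) / ln N].  As [Phi] grows at rate at most
    [t ^ 3 * edge N] there, the gap between them is at least
    [ln ((j + 1) / ln N) / (t ^ 3 * edge N)] up to a constant, and the weight
    decays in the gap at rate [b * edge N], where [b = beta / beta_c]. *)
Lemma order_weight_le N K t beta (x : 'I_(2 ^ N)%N -> R) j :
  1 < t -> 0 < edge N ->
  expR (- (t ^+ 3 * (t - 1) * edge N ^+ 2)) <= 1 - t^-1 ->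
  0 < beta / beta_c -> (1 < N)%N ->
  spread K t x -> (K <= j < 2 ^ N)%N ->
  order_weight beta x j <=
    (4 / expR (- 1) * ln N%:R) `^ (beta / beta_c / t ^+ 3) *
    j.+1%:R `^ (- (beta / beta_c / t ^+ 3)).
Proof.
move=> t1 a0 hE b0 N1 [_ low [i0 hi0] many] /andP[Kj jn].
have t0 : 0 < t by exact: lt_trans t1.
set a := edge N in a0 hE low; set b := beta / beta_c in b0 *.
have nR : 0 < (2 ^ N)%N%:R :> R by rewrite ltr0n expn_gt0.
have lnN : 0 < ln N%:R :> R by rewrite ln_gt0// ltr1n.
have x0j : order_stat x 0 <= order_stat x j by rewrite order_stat_homo.
have n0 : (0 < 2 ^ N)%N by rewrite expn_gt0.
have x0_low : - (t * a) <= order_stat x 0.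
  by rewrite -(order_indexE x (Ordinal n0)) ltW.
have Phij : level N j.+1 < Phi (order_stat x j).
  rewrite ltNge; apply/negP => Pj.
  have down y z : y <= z -> Phi z <= level N j.+1 -> Phi y <= level N j.+1.
    by move=> yz; apply: le_trans; exact: gauss_cdf_homo.
  have := order_stat_lt_card down jn Pj.
  by rewrite ltnNge -ltnS many// ltnS Kj.
have Phi0 : Phi (order_stat x 0) <= 2 * ln N%:R / (2 ^ N)%N%:R.
  by apply: le_trans hi0; rewrite gauss_cdf_homo// order_stat0_le.
have growth : Phi (order_stat x j) <=
    expR (t ^+ 3 * a * (order_stat x j - order_stat x 0)) *
    Phi (order_stat x 0).
  (* With y = t * a and e = (t - 1) * y one has y + e = t ^ 2 * a; the third
     factor t of the rate pays for the correction 1 - exp (- (y + e) * e). *)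
  apply: (@gauss_cdf_growth R _ (t * a) ((t - 1) * (t * a))) => //.
  - by rewrite mulr_gt0.
  - by rewrite !mulr_gt0// subr_gt0.
  have -> : t * a + (t - 1) * (t * a) = t ^+ 3 * a * t^-1.
    by field; rewrite gt_eqF.
  rewrite ler_pM2l ?mulr_gt0 ?exprn_gt0//.
  have -> : t ^+ 3 * a / t * ((t - 1) * (t * a)) = t ^+ 3 * (t - 1) * a ^+ 2.
    by field; rewrite gt_eqF.
  by rewrite lerBrDr addrC -lerBrDr.
set z := _ * (_ - _) in growth.
have r_le : j.+1%:R / (4 / expR (- 1) * ln N%:R) <= expR z.
  have := le_trans (ltW Phij) (le_trans growth (ler_wpM2l (expR_ge0 z) Phi0)).
  rewrite /level mulrA ler_pM2r ?invr_gt0//.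
  have e0 : 0 < expR (- 1) :> R by exact: expR_gt0.
  move: (expR (- 1)) e0 => e e0 H.
  rewrite ler_pdivrMr ?mulr_gt0 ?invr_gt0//.
  have -> : expR z * (4 / e * ln N%:R) = expR z * (2 * ln N%:R) / (e / 2).
    by field; rewrite gt_eqF.
  by rewrite ler_pdivlMr ?divr_gt0// mulrC.
have -> : order_weight beta x j = expR (- (b / t ^+ 3 * z)).
  rewrite /order_weight -/(edge N) -/a -/b; congr (expR (- _)).
  by rewrite /z; field; rewrite gt_eqF.
have r0 : 0 < j.+1%:R / (4 / expR (- 1) * ln N%:R) :> R.
  by rewrite divr_gt0// mulr_gt0// divr_gt0// expR_gt0.
apply: le_trans (expRN_le_powR r0 _ r_le) _.
  by rewrite divr_ge0// ltW// exprn_gt0.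
have c0 : 0 <= 4 / expR (- 1) * ln N%:R :> R.
  by rewrite mulr_ge0 ?(ltW lnN)// divr_ge0 ?expR_ge0.
rewrite powRM ?invr_ge0// [leLHS]mulrC ler_wpM2r ?powR_ge0//.
by rewrite -[_^-1]powR_inv1// -powRrM mulN1r opprK.
Qed.

End spread_levels.

(** * Almost sure bound on the distance *)

(** The discarded weights sum to at most
    [(C * ln N) ^ p * K ^ - (p - 1) / (p - 1)].  Since [p - 1] exceeds
    [s = (b - 1) / 2], a positive power of [K >= N] is left to absorb the
    logarithm, and [2 / (p - 1) <= 2 / s = 4 / (b - 1)]. *)
Lemma dTV_le_of_spread (R : realType) N K t beta
    (sigma : 'I_(2 ^ N)%N -> config N) (x : 'I_(2 ^ N)%N -> R) :
  let b := beta / beta_c in let p := b / t ^+ 3 in let s := (b - 1) / 2 in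
  1 < b -> 1 < t -> s + 1 < p -> (1 < N <= K)%N -> 0 < edge N :> R ->
  expR (- (t ^+ 3 * (t - 1) * edge N ^+ 2)) <= 1 - t^-1 ->
  (4 / expR (- 1) * ln N%:R) `^ p <= N%:R `^ (p - 1 - s) ->
  spread K t x ->
  (dTV (gibbs beta sigma x) (gibbs_approx K beta sigma x) <=
   (4 / (b - 1) * (1 / (K%:R - 1) `^ s))%:E)%E.
Proof.
move=> b p s b1 t1 sp /andP[N1 NK] edge0 hE hN xspread.
have K0 : (0 < K)%N by rewrite (leq_trans _ NK)// ltnW.
have [xinj _ _ _] := xspread.
apply: le_trans (dTV_gibbs_le beta sigma xinj K0) _; rewrite lee_fin.
have s0 : 0 < s by rewrite divr_gt0// subr_gt0.
pose q := p - 1; have q0 : 0 < q by rewrite /q; lra.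
have KR : 0 < K%:R :> R by rewrite ltr0n.
pose c := (4 / expR (- 1) * ln N%:R) `^ p : R.
have tail : \sum_(k < (2 ^ N)%N | (K <= k)%N) order_weight beta x k <=
    c * (K%:R `^ (- q) / q).
  apply: le_trans (ler_wpM2l (powR_ge0 _ _) (pow_tail_sum (2 ^ N) q0 K0)).
  rewrite mulr_sumr; apply: ler_sum => k Kk; rewrite /c /q subrK.
  apply: (order_weight_le t1 edge0 hE _ N1 xspread); last by rewrite Kk ltn_ord.
  exact: lt_trans b1.
have cK : c * K%:R `^ (- q) <= K%:R `^ (- s).
  have -> : K%:R `^ (- s) = K%:R `^ (q - s) * K%:R `^ (- q) :> R.
    rewrite -powRD ?(gt_eqF KR) ?implybT//; congr (_ `^ _); ring.
  rewrite ler_wpM2r ?powR_ge0// (le_trans hN)//.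
  by rewrite ge0_ler_powR ?nnegrE// ?ler_nat// /q; lra.
have K1 : 0 < K%:R - 1 :> R by rewrite subr_gt0 ltr1n (leq_trans N1).
have Ks : K%:R `^ (- s) <= 1 / (K%:R - 1) `^ s :> R.
  rewrite powRN div1r lef_pV2 ?posrE ?powR_gt0//.
  by rewrite ge0_ler_powR ?nnegrE ?(ltW s0) ?(ltW K1) ?(ltW KR)// gerBl.
have -> : 4 / (b - 1) = 2 / s.
  by rewrite /s; field; rewrite gt_eqF// subr_gt0.
apply: le_trans (ler_wpM2l _ tail) _ => //.
have -> : 2 * (c * (K%:R `^ (- q) / q)) = 2 / q * (c * K%:R `^ (- q)) by ring.
apply: ler_pM => //.
- by rewrite divr_ge0// ltW.
- by rewrite mulr_ge0 ?powR_ge0.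
- by rewrite ler_pM2l// lef_pV2 ?posrE// /q; lra.
- exact: le_trans cK Ks.
Qed.

Theorem corollary3p1 (R : realType) (d : measure_display)
    (Omega : measurableType d) (P : probability Omega R)
    (sigma : forall N : nat, 'I_(2 ^ N)%N -> config N)
    (sigma_enum : forall N : nat, (0 < N)%N -> bijective (sigma N))
    (X : forall N : nat, 'I_(2 ^ N)%N -> {RV P >-> R})
    (X_iid : forall N : nat, (0 < N)%N -> iid_standard_gaussian (X N))
    (beta : R) (beta_gt : 1 < beta / beta_c)
    (k : nat -> nat)
    (k_gt0 : forall N : nat, (0 < N)%N -> (0 < k N)%N)
    (k_infty : increases_to_infinity (fun N => (k N)%:R : R))
    (kN_infty : increases_to_infinity (fun N => (k N)%:R / N%:R : R))
    (logk_0 : decreases_to_zero (fun N => ln (k N)%:R / N%:R : R)) :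
  {ae P, forall w : Omega, \forall N \near \oo,
    (dTV (gibbs beta (sigma N) (fun i => X N i w))
         (gibbs_approx (k N) beta (sigma N) (fun i => X N i w))
     <= (4 / (beta / beta_c - 1) *
         (1 / ((k N)%:R - 1) `^ ((beta / beta_c - 1) / 2)))%:E)%E}.
Proof.
set b := beta / beta_c in beta_gt *.
have [t t1 tb] := exists_cube_lt beta_gt.
have t0 : 0 < t by exact: lt_trans t1.
have t3 : 0 < t ^+ 3 by rewrite exprn_gt0.
pose p := b / t ^+ 3; pose s := (b - 1) / 2.
have sp : s + 1 < p by rewrite /s /p ltr_pdivlMr//; lra.
have s0 : 0 < s by rewrite divr_gt0// subr_gt0.
have ln2 : 0 < ln 2 :> R by rewrite ln_gt0// ltr1n.
have c0 : 0 < 4 / expR (- 1) :> R by rewrite divr_gt0// expR_gt0.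
have kge : \forall N \near \oo, (N <= k N)%N.
  case: kN_infty => _ /cvgryPge/(_ 1) kN; near=> N.
  have N0 : (0 < N)%N by near: N; exact: nbhs_infty_gt.
  rewrite -(ler_nat R) -[leLHS]mul1r -ler_pdivlMr ?ltr0n//.
  by near: N.
have edge_large (M : R) : \forall N \near \oo, M <= edge N ^+ 2.
  near=> N; rewrite edge_sqr mulrCA -ler_pdivrMr ?mulr_gt0//.
  by near: N; exact: nbhs_infty_ger.
have : \forall N \near \oo, [/\ (1 < N <= k N)%N, 1 <= edge N :> R,
    expR (- (t ^+ 3 * (t - 1) * edge N ^+ 2)) <= 1 - t^-1 &
    (4 / expR (- 1) * ln N%:R) `^ p <= N%:R `^ (p - 1 - s)].
  near=> N; split.
  - apply/andP; split; first by near: N; exact: nbhs_infty_gt.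
    by near: N.
  - rewrite -(@ler_pXn2r _ 2) ?nnegrE ?edge_ge0// expr1n.
    by near: N; exact: edge_large.
  - have d0 : 0 < t ^+ 3 * (t - 1) by rewrite mulr_gt0// subr_gt0.
    have e0 : 0 < 1 - t^-1 by rewrite subr_gt0 invf_lt1.
    rewrite -ler_ln ?posrE ?expR_gt0// expRK lerNl.
    rewrite mulrC -ler_pdivrMr//; near: N; exact: edge_large.
  - by near: N; apply: near_ln_powR_le => //; lra.
move=> [N0 _ HN].
have bad N : (N0 <= N)%N ->
  prob_le P [set w | ~ spread (k N) t (fun i => X N i w)]
    ((2 + 2 / ((t ^+ 2 - 1) * ln 2) ^+ 2 + 2 / ln 2 ^+ 2) / N%:R ^+ 2).
  move=> /HN[/andP[N1 Nk] e1 _ _]; apply: prob_le_not_spread => //.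
  - by apply: X_iid; exact: ltnW.
  - by rewrite ltnW.
  - by rewrite (le_trans e1)// ler_peMl ?edge_ge0// ltW.
have := borel_cantelli_sqr bad; apply: filterS => w [N1 _ good].
exists (maxn N0 N1) => // N /=.
rewrite geq_max => /andP[/HN[NN e1 hE hN] /good].
move=> /= /contrapT; apply: dTV_le_of_spread => //.
exact: lt_le_trans e1.
Unshelve. all: by end_near. Qed.
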